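(* Let $\tau_g=g(\mathbb{E}\{Y(1)\})-g(\mathbb{E}\{Y(0)\})$ be the experiment effect, with consistent raw estimator $\hat\tau_g=g(\bar Y_t)-g(\bar Y_c)$. Let $f:\mathbb{R}^p\to\mathbb{R}$ be a function of the predictors which does not depend on the experiment arm, write $H_i=f(X_i)$, and consider the adjusted estimator $$\hat\tau_{adj}=\hat\tau_g-\theta\big(g(\bar f_t)-g(\bar f_c)\big),\qquad\theta\in\mathbb{R}.$$ Denote by $(Y_t,H_t)$ the pair $(Y_i,f(X_i))$ for a randomly chosen $i\in t$ and by $(Y_c,H_c)$ the same for the control arm, and let $\rho_c=\mathrm{cor}(Y_c,H_c)$, $\rho_t=\mathrm{cor}(Y_t,H_t)$. Let $V$ denote the first-order (delta-method) approximation of the variance. Then: (a) The optimal $\theta$, which minimizes $V\{\hat\tau_{adj}\}$, lies between $\theta_1$ and $\theta_2$ (i.e. in $[\min\{\theta_1,\theta_2\},\max\{\theta_1,\theta_2\}]$), where $\theta_1$ and $\theta_2$ minimize $V\{g(\bar Y_c)-\theta g(\bar f_c)\}$ and $V\{g(\bar Y_t)-\theta g(\bar f_t)\}$ respectively: $$\theta_1=\frac{g'(\mu_{Y_c})}{g'(\mu_{H_c})}\,\frac{\mathrm{cov}(Y_c,H_c)}{\mathrm{Var}(H_c)},\qquad \theta_2=\frac{g'(\mu_{Y_t})}{g'(\mu_{H_t})}\,\frac{\mathrm{cov}(Y_t,H_t)}{\mathrm{Var}(H_t)}.$$ (b) If moreover $g'(\mu_{H_c})\sigma_{H_c}=g'(\mu_{H_t})\sigma_{H_t}$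 and $\rho_c\,g'(\mu_{Y_c})\sigma_{Y_c}=\rho_t\,g'(\mu_{Y_t})\sigma_{Y_t}$, then for the optimal $\theta$ $$V\{\hat\tau_{adj}\}/V\{\hat\tau_g\}\le 1-\min\{\rho_c^2,\rho_t^2\}.$$
   Context: A randomized experiment has a treatment arm $t$ with $N_t$ units and a control arm $c$ with $N_c$ units. $Y(1)$ and $Y(0)$ denote the response of a random unit under treatment and control; $Y_i$ is the observed response of unit $i$ (distributed as $Y(1)$ if $i\in t$, as $Y(0)$ if $i\in c$), and $X_i\in\mathbb{R}^p$ is its vector of predictors. Units are sampled at random: the pairs $(Y_i,f(X_i))$ are i.i.d. within each arm and independent across the two arms, with finite moments; $f$ is a fixed function. Sample averages: $$\bar Y_t=\tfrac1{N_t}\sum_{i\in t}Y_i,\quad\bar Y_c=\tfrac1{N_c}\sum_{i\in c}Y_i,\quad\bar f_t=\tfrac1{N_t}\sum_{i\in t}f(X_i),\quad\bar f_c=\tfrac1{N_c}\sum_{i\in c}f(X_i).$$ $\mu_Z$ and $\sigma_Z$ denote the mean and standard deviation of a random variable $Z$. First-order (delta-method) variance: for a random vector $U$ with mean $\mu$ and finite second moments and a real function $F$ differentiable at $\mu$, $V\{F(U)\}:=\mathrm{Var}\big(\nabla F(\mu)\cdot(U-\mu)\big)$. The estimators in the claim are regarded as functions of $U=(\bar Y_t,\bar f_t,\bar Y_c,\bar f_c)$, with $\theta$ a fixed parameter. Conventions: $g$ is a real-valued differentiable function whose domain contains the values and means of all variables to which it is applied; $\sigma_{Y_t},\sigma_{Y_c},\sigma_{H_t},\sigma_{H_c}$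 are positive; and $g'$ is nonzero at $\mu_{Y_t},\mu_{Y_c},\mu_{H_t},\mu_{H_c}$. *)

(* Defs.v *)
From HB Require Import structures.
From mathcomp Require Export all_boot all_order all_algebra.
From mathcomp Require Export all_classical all_reals all_analysis.
Export Order.TTheory GRing.Theory Num.Theory.
Export numFieldNormedType.Exports.

Set Implicit Arguments.
Unset Strict Implicit.
Unset Printing Implicit Defensive.

Local Open Scope classical_set_scope.
Local Open Scope ring_scope.

Section moments.
Context d (T : measurableType d) (R : realType) (P : probability T R).
Implicit Types X Y : T -> R.

Definition mean X : R := fine 'E_P[X].
Definition var X : R := fine 'V_P[X].
Definition cov X Y : R := fine (covariance P X Y).
Definition sd X : R := Num.sqrt (var X).
Definition cor X Y : R := cov X Y / (sd X * sd Y).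

End moments.

Section laws.
Context d (T : measurableType d) (R : realType) (P : probability T R).
Context d' (T' : measurableType d').

Definition same_law (Z Z' : T -> T') : Prop :=
  forall A : set T', measurable A -> P (Z @^-1` A) = P (Z' @^-1` A).

Definition mutually_independent (I : finType) (Z : I -> T -> T') : Prop :=
  forall (J : {set I}) (A : I -> set T'),
    (forall i, i \in J -> measurable (A i)) ->
    P (\bigcap_(i in [set` J]) Z i @^-1` A i)
      = (\prod_(i in J) P (Z i @^-1` A i))%E.

End laws.

Section delta_method.
Context (R : realType) (n : nat).

Definition gradient (F : 'rV[R]_n.+1 -> R) (a : 'rV[R]_n.+1) : 'rV[R]_n.+1 :=
  \row_i 'D_(delta_mx 0 i) F a.

Context d (T : measurableType d) (P : probability T R).

Definition mean_vec (U : T -> 'rV[R]_n.+1) : 'rV[R]_n.+1 :=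
  \row_i mean P (fun w => U w 0 i).

Definition delta_var (F : 'rV[R]_n.+1 -> R) (U : T -> 'rV[R]_n.+1) : R :=
  var P (fun w =>
    \sum_i gradient F (mean_vec U) 0 i * (U w 0 i - mean_vec U 0 i)).

End delta_method.

Definition sample_mean (T : Type) (R : realType) (I : finType) (A : {set I})
    (Z : I -> T -> R) (w : T) : R :=
  (\sum_(i in A) Z i w) / #|A|%:R.

(* The vector (\bar Y_t, \bar f_t, \bar Y_c, \bar f_c), in this order; the
   estimators below read their arguments off these coordinates. *)
Definition averages (T : Type) (R : realType) (I : finType) (t c : {set I})
    (Y H : I -> T -> R) (w : T) : 'rV[R]_4 :=
  \row_(j < 4) [:: sample_mean t Y w; sample_mean t H w;
                   sample_mean c Y w; sample_mean c H w]`_j.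

Section estimators.
Context (R : realType) (g : R -> R).
Implicit Types u : 'rV[R]_4.

Definition tau_raw u : R := g (u 0 0) - g (u 0 2).
Definition tau_adj (theta : R) u : R :=
  tau_raw u - theta * (g (u 0 1) - g (u 0 3)).
Definition arm_t_adj (theta : R) u : R := g (u 0 0) - theta * g (u 0 1).
Definition arm_c_adj (theta : R) u : R := g (u 0 2) - theta * g (u 0 3).

(* g'(mu_Y) / g'(mu_H) * cov(Y, H) / Var(H). *)
Definition theta_arm d (T : measurableType d) (P : probability T R)
    (Y H : T -> R) : R :=
  derive1 g (mean P Y) / derive1 g (mean P H) * (cov P Y H / var P H).

End estimators.

Definition minimizes (R : realType) (h : R -> R) (x : R) : Prop :=
  forall y, h x <= h y.

(* Main.v *)
Require Import Defs.
From mathcomp Require Import measurable_realfun ring.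

(* All the estimators are linear combinations of g evaluated at the four sample
   means, so V is the variance of a linear combination of these means.  Units
   are independent, hence this variance splits into the contributions
     a^2 Var Y + 2 a b cov(Y, H) + b^2 Var H
   of the two arms, each divided by the size of the arm.  As a function of
   theta, V(tau_adj) is therefore C - 2 theta (Bt + Bc) + theta^2 (At + Ac),
   the sum of the quadratics of the two arms; its minimizer is the mediant of
   the arm minimizers Bt / At and Bc / Ac.  Under the assumptions of (b), with
   s = g'(mu_H) sigma_H and k = rho g'(mu_Y) sigma_Y, the optimum is k / s and
   the variance drops by k^2 / N_t + k^2 / N_c, where k^2 / N_t is rho_t^2 times
   the contribution of the treatment arm to V(tau_raw), and likewise for c. *)

Set Implicit Arguments.
Unset Strict Implicit.
Unset Printing Implicit Defensive.

Local Open Scope classical_set_scope.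
Local Open Scope ring_scope.

(** * Expectations under equality in law *)

Lemma mean_same_law d (T : measurableType d) (R : realType)
    (P : probability T R) d' (T' : measurableType d') (Z Z' : T -> T')
    (h : T' -> R) :
  measurable_fun setT Z -> measurable_fun setT Z' -> measurable_fun setT h ->
  same_law P Z Z' -> mean P (h \o Z) = mean P (h \o Z').
Proof.
move=> mZ mZ' mh ZZ'; congr fine; rewrite unlock.
pose X : {mfun T >-> T'} := [the {mfun T >-> T'} of mfun_Sub (mem_set mZ)].
pose X' : {mfun T >-> T'} := [the {mfun T >-> T'} of mfun_Sub (mem_set mZ')].
(* For nonnegative [k], both sides are integrals of [k] against the common law of [Z] and [Z']. The
   signed case follows by treating positive and negative parts separately. *)
have int_eq (k : T' -> \bar R) : @measurable_fun _ _ T' (\bar R) setT k ->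
    (forall y, 0 <= k y)%E -> (\int[P]_w k (Z w) = \int[P]_w k (Z' w))%E.
  move=> mk k0.
  rewrite -[LHS](@ge0_integral_distribution _ _ _ _ _ P X)//.
  rewrite -[RHS](@ge0_integral_distribution _ _ _ _ _ P X')//.
  by apply: eq_measure_integral => A mA _; exact: ZZ'.
have mEh : measurable_fun setT (EFin \o h) by exact/measurable_EFinP.
rewrite integralE [RHS]integralE; congr (_ - _)%E.
  transitivity (\int[P]_w (EFin \o h)^\+ (Z w))%E.
    by apply: eq_integral => w _; rewrite !funeposE.
  rewrite int_eq//; last exact: measurable_funepos.
  by apply: eq_integral => w _; rewrite !funeposE.
transitivity (\int[P]_w (EFin \o h)^\- (Z w))%E.
  by apply: eq_integral => w _; rewrite !funenegE.
rewrite int_eq//; last exact: measurable_funeneg.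
by apply: eq_integral => w _; rewrite !funenegE.
Qed.

(** * Expectation of a product of independent variables *)

Section independence.
Context d (T : measurableType d) (R : realType) (P : probability T R).
Local Open Scope ereal_scope.

(** Independence makes the joint law of [X] and [Y] the product of the marginal laws, so the
    integral of [z.1 * z.2] factors by Fubini. *)
Lemma expectation_mul_indep (X Y : T -> R) :
    X \in Lfun P 1 -> Y \in Lfun P 1 -> (X * Y)%R \in Lfun P 1 ->
    (forall A B, measurable A -> measurable B ->
      P (X @^-1` A `&` Y @^-1` B) = P (X @^-1` A) * P (Y @^-1` B)) ->
  'E_P[X * Y] = 'E_P[X] * 'E_P[Y].
Proof.
move=> X1 Y1 XY1 XYI.
have mX : measurable_fun setT X by case/andP: X1 => /set_mem.
have mY : measurable_fun setT Y by case/andP: Y1 => /set_mem.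
have mXY := measurable_fun_pair mX mY.
pose X' : {RV P >-> R} := mfun_Sub (mem_set mX).
pose Y' : {RV P >-> R} := mfun_Sub (mem_set mY).
pose Z : {RV P >-> (R * R)%type} := mfun_Sub (mem_set mXY).
pose f (z : (R * R)%type) : \bar R := (z.1 * z.2)%:E.
have mf : measurable_fun setT f.
  by apply/measurable_EFinP; apply: measurable_funM;
    [exact: measurable_fst|exact: measurable_snd].
(* The product measure is determined by its values on rectangles, and there [XYI] gives the
   agreement. *)
have prodE A : measurable A ->
    (distribution P X' \x distribution P Y') A = distribution P Z A.
  by apply: product_measure_unique => B C mB mC; exact: XYI.
have fZ : P.-integrable setT (f \o Z) by exact/Lfun1_integrable.
(* Fubini asks for integrability under the product law; it is carried over from the joint law, where
   it amounts to integrability of [X * Y]. *)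
have fint : (distribution P X' \x distribution P Y').-integrable setT f.
  have /integrableP[_ foo] : (distribution P Z).-integrable setT f.
    by apply: integrable_pushforward => //; rewrite preimage_setT.
  apply/integrableP; split => //; apply: le_lt_trans foo.
  rewrite le_eqVlt; apply/orP; left; apply/eqP.
  by apply: eq_measure_integral => A mA _; exact: prodE.
have EY : \int[distribution P Y']_y y%:E = 'E_P[Y].
  by rewrite unlock integral_distribution//; exact/Lfun1_integrable.
have EYfin := expectation_fin_num Y1.
have iX : (distribution P X').-integrable setT EFin.
  apply: integrable_pushforward => //.
  by rewrite preimage_setT; exact/Lfun1_integrable.
have iY : (distribution P Y').-integrable setT EFin.
  apply: integrable_pushforward => //.
  by rewrite preimage_setT; exact/Lfun1_integrable.
have EXE : \int[distribution P X']_y y%:E = 'E_P[X].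
  by rewrite unlock integral_distribution//; exact/Lfun1_integrable.
transitivity (\int[distribution P Z]_z f z).
  by rewrite integral_distribution// unlock.
transitivity (\int[distribution P X' \x distribution P Y']_z f z).
  by apply/esym; apply: eq_measure_integral => A mA _; exact: prodE.
rewrite -integral12_prod_meas1//.
transitivity (\int[distribution P X']_x (x%:E * 'E_P[Y])).
  apply: eq_integral => x _; rewrite /fubini_F /f /=.
  under eq_integral do rewrite EFinM.
  by rewrite integralZl// EY.
by rewrite -(fineK EYfin) integralZr// EXE.
Qed.
End independence.

(** * Bilinearity of the covariance on square-integrable variables *)

Section moments_L2.
Context d (T : measurableType d) (R : realType) (P : probability T R).
Implicit Types X Y Z : T -> R.

Let Pfin : P setT \is a fin_num := fin_num_measure P _ measurableT.

Lemma LfunZ2 (a : R) X : X \in Lfun P 2%:E ->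
  (fun w => a * X w) \in Lfun P 2%:E.
Proof.
move=> X2; rewrite (_ : (fun w => _) = a \o* X); last first.
  by apply/funext => w /=; rewrite mulrC.
by apply: Lfun_scale => //; rewrite ler1n.
Qed.

Lemma Lfun_lin2 (a b : R) X Y : X \in Lfun P 2%:E -> Y \in Lfun P 2%:E ->
  (fun w => a * X w + b * Y w) \in Lfun P 2%:E.
Proof.
move=> X2 Y2; rewrite -[X in X \in _]/((fun w => a * X w) + (fun w => b * Y w)).
by apply: rpredD => [|?|?]; [rewrite lee_fin ler1n|exact: LfunZ2|exact: LfunZ2].
Qed.

Lemma covC X Y : cov P X Y = cov P Y X.
Proof. by rewrite /cov covarianceC. Qed.

Lemma covariance_fin_num_L2 X Y : X \in Lfun P 2%:E -> Y \in Lfun P 2%:E ->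
  covariance P X Y \is a fin_num.
Proof.
by move=> X2 Y2; rewrite covariance_fin_num ?Lfun2_mul_Lfun1 ?Lfun_subset12.
Qed.

Lemma cov_lin2l (a b : R) X Y Z :
    X \in Lfun P 2%:E -> Y \in Lfun P 2%:E -> Z \in Lfun P 2%:E ->
  cov P (fun w => a * X w + b * Y w) Z = a * cov P X Z + b * cov P Y Z.
Proof.
move=> X2 Y2 Z2.
have -> : (fun w => a * X w + b * Y w) = (a \o* X) \+ (b \o* Y).
  by apply/funext => w /=; rewrite ![_ * X w]mulrC ![_ * Y w]mulrC.
rewrite /cov covarianceDl ?Lfun_scale// ?ler1n//.
rewrite !covarianceZl ?Lfun2_mul_Lfun1 ?Lfun_subset12//.
by rewrite fineD ?fineM ?fin_numM ?covariance_fin_num_L2.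
Qed.

Lemma Lfun_sum2 (I : Type) (r : seq I) (X : I -> T -> R) :
  (forall i, X i \in Lfun P 2%:E) ->
  (fun w => \sum_(i <- r) X i w) \in Lfun P 2%:E.
Proof.
move=> X2; rewrite (_ : (fun w => _) = \sum_(i <- r) X i); last first.
  by apply/funext => w; rewrite fct_sumE.
by apply: rpred_sum => [|? i _]; [rewrite lee_fin ler1n|exact: X2].
Qed.

Lemma mean_sum (I : Type) (r : seq I) (A : pred I) (X : I -> T -> R) :
  (forall i, X i \in Lfun P 2%:E) ->
  mean P (fun w => \sum_(i <- r | A i) X i w) =
  \sum_(i <- r | A i) mean P (X i).
Proof.
move=> X2.
have X1 i := Lfun_subset12 Pfin (X2 i).
(* Filtering the list turns the conditional sum into a plain one, ready for induction. *)
rewrite -big_filter; under eq_fun do rewrite -big_filter.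
elim: [seq i <- r | A i] => {r} [|i r IH].
  rewrite big_nil /mean (_ : (fun w => _) = cst 0) ?expectation_cst//.
  by apply/funext => w; rewrite big_nil.
have S1 := Lfun_subset12 Pfin (Lfun_sum2 r X2).
rewrite big_cons -IH /mean -fineD ?expectation_fin_num// -expectationD//.
by congr (fine (expectation _ _)); apply/funext => w; rewrite big_cons.
Qed.

Lemma meanZ (a : R) X : X \in Lfun P 2%:E ->
  mean P (fun w => a * X w) = a * mean P X.
Proof.
move=> /(Lfun_subset12 Pfin) X1; rewrite /mean.
have -> : (fun w => a * X w) = a \o* X by apply/funext => w /=; rewrite mulrC.
by rewrite expectationZl// fineM// expectation_fin_num.
Qed.

Lemma cov_suml (I : Type) (r : seq I) (X : I -> T -> R) Z :
    (forall i, X i \in Lfun P 2%:E) -> Z \in Lfun P 2%:E ->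
  cov P (fun w => \sum_(i <- r) X i w) Z = \sum_(i <- r) cov P (X i) Z.
Proof.
move=> X2 Z2; elim: r => [|i r IH].
  rewrite big_nil /cov (_ : (fun w => _) = cst 0) ?covariance_cst_l//.
  by apply/funext => w; rewrite big_nil.
rewrite big_cons -IH -[cov P (X i) Z]mul1r -[X in _ + X]mul1r.
rewrite -cov_lin2l//; last exact: Lfun_sum2.
by congr cov; apply/funext => w; rewrite big_cons !mul1r.
Qed.

Lemma var_sum_uncorrelated (I : finType) (X : I -> T -> R) :
    (forall i, X i \in Lfun P 2%:E) ->
    (forall i j, i != j -> cov P (X i) (X j) = 0) ->
  var P (fun w => \sum_i X i w) = \sum_i var P (X i).
Proof.
(* A variance unfolds to the covariance of a variable with itself, so bilinearity applies and only
   the diagonal terms survive. *)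
move=> X2 X0; rewrite -[LHS]/(cov P _ _) cov_suml//; last exact: Lfun_sum2.
apply: eq_bigr => i _; rewrite covC cov_suml// (bigD1 i)//= big1 ?addr0// => j ji.
exact: X0.
Qed.

Lemma var_lin2 (a b : R) X Y : X \in Lfun P 2%:E -> Y \in Lfun P 2%:E ->
  var P (fun w => a * X w + b * Y w) =
  a ^+ 2 * var P X + 2 * (a * b) * cov P X Y + b ^+ 2 * var P Y.
Proof.
move=> X2 Y2; rewrite -[LHS]/(cov P _ _) cov_lin2l//; last exact: Lfun_lin2.
rewrite (covC X) (covC Y) !cov_lin2l// (covC Y X).
rewrite -[cov P X X]/(var P X) -[cov P Y Y]/(var P Y); ring.
Qed.

Lemma var_ge0 X : 0 <= var P X.
Proof. by rewrite fine_ge0// variance_ge0. Qed.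

Lemma sqr_sd X : sd P X ^+ 2 = var P X.
Proof. by rewrite sqr_sqrtr// var_ge0. Qed.

Lemma cov_sd_cor X Y : 0 < sd P X -> 0 < sd P Y ->
  cov P X Y = cor P X Y * sd P X * sd P Y.
Proof.
by move=> X0 Y0; rewrite /cor -mulrA divfK// mulf_neq0// gt_eqF.
Qed.

(** Measurable functions of independent variables are independent, hence uncorrelated. With [h] and
    [k] taken as projections, independence of the pairs of two units yields every covariance between
    them. *)
Lemma cov_indep d' (T' : measurableType d') (V W : T -> T') (h k : T' -> R) :
    measurable_fun setT h -> measurable_fun setT k ->
    h \o V \in Lfun P 2%:E -> k \o W \in Lfun P 2%:E ->
    (forall A B, measurable A -> measurable B ->
      P (V @^-1` A `&` W @^-1` B) = (P (V @^-1` A) * P (W @^-1` B))%E) ->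
  cov P (h \o V) (k \o W) = 0.
Proof.
move=> mh mk hV2 kW2 VW.
have hkVW1 := Lfun2_mul_Lfun1 hV2 kW2.
have hV1 := Lfun_subset12 Pfin hV2.
have kW1 := Lfun_subset12 Pfin kW2.
rewrite /cov covarianceE// expectation_mul_indep//.
  by rewrite subee// fin_numM// expectation_fin_num.
move=> A B mA mB; apply: (VW (h @^-1` A) (k @^-1` B)).
  by rewrite -[X in measurable X]setTI; exact: mh.
by rewrite -[X in measurable X]setTI; exact: mk.
Qed.

Lemma var_subr_cst X (k : R) : X \in Lfun P 2%:E ->
  var P (fun w => X w - k) = var P X.
Proof. by move=> X2; rewrite /var -(varianceB_cst_r k X2). Qed.
End moments_L2.

(** * Partial derivatives of sums of functions of single coordinates *)

Section coordinates.
Context (R : realType) (n : nat).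
Implicit Types (u m : 'rV[R]_n.+1) (g : R -> R).

(** Along the basis vector [i], coordinate [j] moves at unit speed if [i = j] and stays fixed
    otherwise, so the difference quotient is that of [g] or identically zero. *)
Lemma is_derive_coord g m (i j : 'I_n.+1) : derivable g (m 0 j) 1 ->
  is_derive m (delta_mx 0 i : 'rV[R]_n.+1) (fun u => g (u 0 j))
    ((i == j)%:R * derive1 g (m 0 j)).
Proof.
case: (eqVneq i j) => [<-{j}|ij] dg.
  rewrite mul1r derive1E.
  have E : (fun h =>
      h^-1 *: ((fun u => g (u 0 i)) (h *: delta_mx 0 i + m) - g (m 0 i))) = (fun h => h^-1 *: (g (h *: 1 + m 0 i) - g (m 0 i))).
    apply/funext => h; rewrite !mxE !eqxx/= mulr1.
    by rewrite -[h *: 1]/(h * 1) mulr1.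
  by split; rewrite /derivable /derive /= E.
rewrite mul0r.
have E : (fun h =>
    h^-1 *: ((fun u => g (u 0 j)) (h *: delta_mx 0 i + m) - g (m 0 j))) = (fun h => 0).
  by apply/funext => h; rewrite !mxE (eq_sym j) (negPf ij) andbF mulr0
    add0r subrr scaler0.
by split; rewrite /derivable /derive /= E; [exact: is_cvg_cst|exact: lim_cst].
Qed.

Lemma gradient_sum_coord g (k : 'I_n.+1 -> R) m :
  (forall j, derivable g (m 0 j) 1) ->
  gradient (fun u => \sum_j k j * g (u 0 j)) m =
  \row_i (k i * derive1 g (m 0 i)).
Proof.
move=> dg; apply/rowP => i; rewrite !mxE.
rewrite (_ : (fun u => _) = \sum_j (k j \*: (fun u => g (u 0 j)))); last first.
  by apply/funext => u; rewrite fct_sumE.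
have d j := is_derive_coord i (dg j).
rewrite derive_sum; last by move=> j; apply: derivableZ; apply: ex_derive.
rewrite (bigD1 i)//= big1 => [|j ji].
  by rewrite deriveZ ?derive_val// eqxx mul1r addr0.
by rewrite deriveZ ?derive_val// eq_sym (negPf ji) mul0r scaler0.
Qed.

End coordinates.

(** * Minimizing a quadratic, and the mediant inequality *)

Section quadratics.
Context (R : realType).

(** Completing the square; positivity of [A] makes the minimizer unique, whence the equivalence. *)
Lemma minimizes_quadratic (h : R -> R) (A B C : R) : 0 < A ->
  (forall x, h x = C - 2 * x * B + x ^+ 2 * A) ->
  forall x, minimizes h x <-> x = B / A.
Proof.
move=> A0 hE x.
have hB y : h y = h (B / A) + A * (y - B / A) ^+ 2.
  by rewrite !hE; field; rewrite gt_eqF.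
split=> [/(_ (B / A))|-> y]; last first.
  by rewrite (hB y) lerDl mulr_ge0 ?sqr_ge0 ?ltW.
(* A minimizer has A (x - B/A)^2 <= 0, so the square vanishes. *)
rewrite (hB x) gerDl pmulr_rle0// => /(conj (sqr_ge0 (x - B / A))) /andP.
by rewrite -eq_le eq_sym sqrf_eq0 subr_eq0 => /eqP.
Qed.

(** The middle term is the average of [x1] and [x2] with positive weights [A1] and [A2]. *)
Lemma mediant_between (A1 A2 x1 x2 : R) : 0 < A1 -> 0 < A2 ->
  Num.min x1 x2 <= (A1 * x1 + A2 * x2) / (A1 + A2) <= Num.max x1 x2.
Proof.
move=> A1_gt0 A2_gt0.
have A0 : 0 < A1 + A2 by exact: addr_gt0.
rewrite ler_pdivlMr// ler_pdivrMr// !mulrDr ![_ * A1]mulrC ![_ * A2]mulrC.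
apply/andP; split; apply: lerD; rewrite ler_pM2l//;
  by rewrite ?ge_min ?le_max lexx ?orbT.
Qed.
End quadratics.

(** * Variance of linear combinations of the arm averages *)

Section arms.
Context d (T : measurableType d) (R : realType) (P : probability T R).
Context (I : finType) (t c : {set I}) (Y H : I -> T -> R).
Hypotheses (arms : c = ~: t).
Hypotheses (Y2 : forall i, Y i \in Lfun P 2%:E)
  (H2 : forall i, H i \in Lfun P 2%:E).

Lemma mean_sample_mean (A : {set I}) (Z : I -> T -> R) (mu : R) :
    (forall i, Z i \in Lfun P 2%:E) -> (0 < #|A|)%N ->
    (forall i, i \in A -> mean P (Z i) = mu) ->
  mean P (sample_mean A Z) = mu.
Proof.
move=> Z2 A0 Zmu; rewrite /sample_mean; under eq_fun do rewrite mulrC.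
rewrite meanZ; last first.
  by under eq_fun do rewrite -big_filter; exact: Lfun_sum2.
rewrite mean_sum// (eq_bigr (fun=> mu))// sumr_const -[mu *+ _]mulr_natl mulKf//.
by rewrite pnatr_eq0 -lt0n.
Qed.

Hypothesis uncor : forall i j, i != j ->
  [/\ cov P (Y i) (Y j) = 0, cov P (Y i) (H j) = 0 & cov P (H i) (H j) = 0].

Lemma var_sample_means (a1 a2 a3 a4 : R) :
  var P (fun w => a1 * sample_mean t Y w + a2 * sample_mean t H w +
                  (a3 * sample_mean c Y w + a4 * sample_mean c H w)) =
  (\sum_(i in t) var P (fun w => a1 * Y i w + a2 * H i w)) / #|t|%:R ^+ 2 +
  (\sum_(i in c) var P (fun w => a3 * Y i w + a4 * H i w)) / #|c|%:R ^+ 2.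
Proof.
(* The share of unit [i] in the whole combination, with the size of its arm absorbed into the
   coefficients; distinct shares are uncorrelated. *)
pose Z i w := if i \in t then (a1 / #|t|%:R) * Y i w + (a2 / #|t|%:R) * H i w
  else (a3 / #|c|%:R) * Y i w + (a4 / #|c|%:R) * H i w.
have Z2 i : Z i \in Lfun P 2%:E by rewrite /Z; case: (i \in t); exact: Lfun_lin2.
have Z0 i j : i != j -> cov P (Z i) (Z j) = 0.
  move=> ij; have [_ YH _] := uncor ij.
  (* [uncor] at the swapped indices supplies the covariance of [H i] with [Y j], and the orders of
     arguments left by linearity on the left. *)
  have [YY YH' HH] : [/\ cov P (Y j) (Y i) = 0, cov P (Y j) (H i) = 0
      & cov P (H j) (H i) = 0] by apply: uncor; rewrite eq_sym.
  have lin (a b a' b' : R) : cov P (fun w => a * Y i w + b * H i w)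
      (fun w => a' * Y j w + b' * H j w) = 0.
    rewrite cov_lin2l//; last exact: Lfun_lin2.
    rewrite (covC _ (Y i)) (covC _ (H i)) !cov_lin2l//.
    by rewrite YY YH' HH (covC _ (H j)) YH; ring.
  by rewrite /Z; case: (i \in t); case: (j \in t); exact: lin.
transitivity (var P (fun w => \sum_i Z i w)).
  congr var; apply/funext => w; rewrite (bigID (mem t))/=; congr (_ + _).
    rewrite /sample_mean !mulrA ![_ * (\sum_(_ in _) _) / _]mulrAC.
    rewrite !mulr_sumr -big_split/=; apply: eq_bigr => i it.
    by rewrite /Z it.
  rewrite arms /sample_mean !mulrA ![_ * (\sum_(_ in _) _) / _]mulrAC.
  rewrite !mulr_sumr -big_split/=; apply: eq_big => i; first by rewrite inE.
  by rewrite /Z arms inE => /negPf ->.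
rewrite var_sum_uncorrelated// (bigID (mem t))/= !mulr_suml; congr (_ + _).
  apply: eq_bigr => i it; rewrite /Z it !var_lin2// -exprVn; ring.
apply: eq_big => i; first by rewrite arms inE.
by move=> /negPf it; rewrite /Z it !var_lin2// -exprVn; ring.
Qed.
End arms.

(** * From laws of pairs to moments, and from mutual to pairwise independence *)

Definition same_moments d (T : measurableType d) (R : realType)
    (P : probability T R) (X Y X' Y' : T -> R) : Prop :=
  [/\ mean P X = mean P X', mean P Y = mean P Y', var P X = var P X',
      cov P X Y = cov P X' Y' & var P Y = var P Y'].

(** These five moments are what the delta-method variance of an arm depends on, and each is an
    expectation of a function of the pair. *)
Lemma same_law_moments d (T : measurableType d) (R : realType)
    (P : probability T R) (X Y X' Y' : T -> R) :
  measurable_fun setT X -> measurable_fun setT Y ->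
  measurable_fun setT X' -> measurable_fun setT Y' ->
  same_law P (fun w => (X w, Y w)) (fun w => (X' w, Y' w)) ->
  same_moments P X Y X' Y'.
Proof.
move=> mX mY mX' mY' XYE.
have mXY := measurable_fun_pair mX mY.
have mXY' := measurable_fun_pair mX' mY'.
have meanE (h : R * R -> R) : measurable_fun setT h ->
    mean P (fun w => h (X w, Y w)) = mean P (fun w => h (X' w, Y' w)).
  by move=> mh; exact: (mean_same_law mXY mXY' mh XYE).
have covE Z Z' : cov P Z Z' =
    mean P (fun w => (Z w - mean P Z) * (Z' w - mean P Z')).
  by rewrite /cov unlock.
have mf : measurable_fun setT (fst : R * R -> R) by exact: measurable_fst.
have ms : measurable_fun setT (snd : R * R -> R) by exact: measurable_snd.
have mean1 : mean P X = mean P X' := meanE fst mf.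
have mean2 : mean P Y = mean P Y' := meanE snd ms.
(* Once the means agree, both sides are centred at the same constants [a] and [b], so a single
   function of the pair is integrated. *)
have mulE (h k : R * R -> R) (a b : R) :
    measurable_fun setT h -> measurable_fun setT k ->
    mean P (fun w => (h (X w, Y w) - a) * (k (X w, Y w) - b)) =
    mean P (fun w => (h (X' w, Y' w) - a) * (k (X' w, Y' w) - b)).
  move=> mh mk; apply: (meanE (fun z => (h z - a) * (k z - b))).
  by apply: measurable_funM; apply: measurable_funB.
split=> //.
- rewrite -[LHS]/(cov P X X) -[RHS]/(cov P X' X') !covE -mean1.
  exact: (mulE fst fst).
- by rewrite !covE -mean1 -mean2; exact: (mulE fst snd).
- rewrite -[LHS]/(cov P Y Y) -[RHS]/(cov P Y' Y') !covE -mean2.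
  exact: (mulE snd snd).
Qed.

Lemma mutually_independent2 d (T : measurableType d) (R : realType)
    (P : probability T R) d' (T' : measurableType d') (I : finType)
    (Z : I -> T -> T') (i j : I) (A B : set T') :
  mutually_independent P Z -> i != j -> measurable A -> measurable B ->
  P (Z i @^-1` A `&` Z j @^-1` B) = (P (Z i @^-1` A) * P (Z j @^-1` B))%E.
Proof.
move=> ZI ij mA mB.
(* The family of events is [A] at [i] and [B] at any other index; as [i != j], its value at [j] is
   [B]. *)
have := ZI [set i; j]%SET (fun k => if k == i then A else B).
have mAB k : measurable (if k == i then A else B) by case: (k == i).
move=> /(_ (fun k _ => mAB k)).
rewrite big_setU1 ?inE// big_set1 eqxx eq_sym (negPf ij) => <-.
congr (P _); apply/seteqP; split => w /=.
  by move=> [Aw Bw] k /=; rewrite !inE => /orP[] /eqP ->;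
    rewrite ?eqxx// eq_sym (negPf ij).
move=> ABw; split.
  by have := ABw i; rewrite /= eqxx; apply; rewrite !inE eqxx.
by have := ABw j; rewrite /= eq_sym (negPf ij); apply; rewrite !inE eqxx orbT.
Qed.

(** * Delta-method variance of functions of the averages *)

Lemma delta_var_sum_coord (R : realType) n d (T : measurableType d)
    (P : probability T R) (g : R -> R) (k : 'I_n.+1 -> R)
    (U : T -> 'rV[R]_n.+1) (m := mean_vec P U) :
  (forall j, derivable g (m 0 j) 1) ->
  (forall j, (fun w => U w 0 j) \in Lfun P 2%:E) ->
  delta_var P (fun u => \sum_j k j * g (u 0 j)) U =
  var P (fun w => \sum_j k j * derive1 g (m 0 j) * U w 0 j).
Proof.
move=> dg U2; rewrite /delta_var gradient_sum_coord//.
(* Centring at [m] shifts the linear form by a constant, which leaves the variance unchanged. *)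
rewrite -[RHS](var_subr_cst (\sum_j k j * derive1 g (m 0 j) * m 0 j)); last first.
  apply: (@Lfun_sum2 _ _ _ _ _ _ (fun j w => k j * derive1 g (m 0 j) * U w 0 j)).
  by move=> j; exact: (LfunZ2 _ (U2 j)).
congr var; apply/funext => w; rewrite -sumrB; apply: eq_bigr => j _.
by rewrite mxE mulrBr.
Qed.

Section averages.
Context d (T : measurableType d) (R : realType) (P : probability T R).
Context (I : finType) (t c : {set I}) (Y H : I -> T -> R) (Yt Ht Yc Hc : T -> R).
Hypotheses (arms : c = ~: t) (t_gt0 : (0 < #|t|)%N) (c_gt0 : (0 < #|c|)%N).
Hypotheses (Y2 : forall i, Y i \in Lfun P 2%:E)
  (H2 : forall i, H i \in Lfun P 2%:E).
Hypothesis uncor : forall i j, i != j ->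
  [/\ cov P (Y i) (Y j) = 0, cov P (Y i) (H j) = 0 & cov P (H i) (H j) = 0].
Hypothesis mom_t : forall i, i \in t -> same_moments P (Y i) (H i) Yt Ht.
Hypothesis mom_c : forall i, i \in c -> same_moments P (Y i) (H i) Yc Hc.
Variable g : R -> R.
Hypotheses (dYt : derivable g (mean P Yt) 1) (dHt : derivable g (mean P Ht) 1).
Hypotheses (dYc : derivable g (mean P Yc) 1) (dHc : derivable g (mean P Hc) 1).

(** The variance of a g'(mu_Y) Y + b g'(mu_H) H, that is, the contribution of one unit before
    division by the arm size. *)
Let q (Y H : T -> R) (a b : R) := (a * derive1 g (mean P Y)) ^+ 2 * var P Y
  + 2 * (a * derive1 g (mean P Y) * (b * derive1 g (mean P H))) * cov P Y H
  + (b * derive1 g (mean P H)) ^+ 2 * var P H.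

Lemma delta_var_averages (k : seq R) :
  delta_var P (fun u : 'rV[R]_4 => \sum_(j < 4) k`_j * g (u 0 j))
    (averages t c Y H) =
  q Yt Ht k`_0 k`_1 / #|t|%:R + q Yc Hc k`_2 k`_3 / #|c|%:R.
Proof.
pose mu := [:: mean P Yt; mean P Ht; mean P Yc; mean P Hc].
have muE : mean_vec P (averages t c Y H) = \row_(j < 4) mu`_j.
  apply/rowP => -[j j4]; rewrite !mxE.
  under eq_fun do rewrite mxE.
  by case: j j4 => [|[|[|[|//]]]] j4 /=; apply: mean_sample_mean => // i;
    [move=> /mom_t[]|move=> /mom_t[]|move=> /mom_c[]|move=> /mom_c[]].
have sm2 (A : {set I}) Z : (forall i, Z i \in Lfun P 2%:E) ->
    sample_mean A Z \in Lfun P 2%:E.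
  move=> Z2.
  have S2 : (fun w => \sum_(i in A) Z i w) \in Lfun P 2%:E.
    by under eq_fun do rewrite -big_filter; exact: Lfun_sum2.
  by rewrite /sample_mean; under eq_fun do rewrite mulrC; exact: LfunZ2.
rewrite delta_var_sum_coord; last 2 first.
- rewrite muE => -[j j4]; rewrite mxE.
  case: j j4 => [|[|[|[|j]]]] j4; [exact: dYt|exact: dHt|exact: dYc|exact: dHc|].
  by exfalso.
- move=> [j j4]; under eq_fun do rewrite mxE.
  by case: j j4 => [|[|[|[|//]]]] j4 /=; exact: sm2.
transitivity (var P (fun w =>
  k`_0 * derive1 g (mean P Yt) * sample_mean t Y w +
  k`_1 * derive1 g (mean P Ht) * sample_mean t H w +
  (k`_2 * derive1 g (mean P Yc) * sample_mean c Y w +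
   k`_3 * derive1 g (mean P Hc) * sample_mean c H w))).
  congr var; apply/funext => w.
  by rewrite muE !big_ord_recl big_ord0 !mxE/= addr0 addrA.
rewrite var_sample_means//; congr (_ + _).
  (* A sum of [#|t|] equal terms over the square of [#|t|] leaves one factor [#|t|] in the
     denominator. *)
  rewrite (eq_bigr (fun=> q Yt Ht k`_0 k`_1)) => [|i /mom_t[_ _ vY cYH vH]].
    rewrite sumr_const -[_ *+ _]mulr_natl; field.
    by rewrite pnatr_eq0 -lt0n.
  by rewrite var_lin2// vY cYH vH.
rewrite (eq_bigr (fun=> q Yc Hc k`_2 k`_3)) => [|i /mom_c[_ _ vY cYH vH]].
  rewrite sumr_const -[_ *+ _]mulr_natl; field.
  by rewrite pnatr_eq0 -lt0n.
by rewrite var_lin2// vY cYH vH.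
Qed.
End averages.

(** * Estimators as coefficient lists, in the order of [averages] *)

Lemma tau_adj_coord (R : realType) (g : R -> R) (theta : R) :
  tau_adj g theta =
  fun u => \sum_(j < 4) [:: 1; - theta; - 1; theta]`_j * g (u 0 j).
Proof.
apply/funext => u; rewrite !big_ord_recl big_ord0 /tau_adj /tau_raw /=.
have -> : lift ord0 ord0 = 1 :> 'I_4 by exact/val_inj.
have -> : lift ord0 (lift ord0 ord0) = 2 :> 'I_4 by exact/val_inj.
have -> : lift ord0 (lift ord0 (lift ord0 ord0)) = 3 :> 'I_4 by exact/val_inj.
have -> : ord0 = 0 :> 'I_4 by exact/val_inj.
ring.
Qed.

Lemma tau_raw_coord (R : realType) (g : R -> R) :
  tau_raw g = fun u => \sum_(j < 4) [:: 1; 0; - 1; 0]`_j * g (u 0 j).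
Proof.
(* The raw estimator is the adjusted one at theta = 0. *)
transitivity (tau_adj g 0); last by rewrite tau_adj_coord oppr0.
by apply/funext => u; rewrite /tau_adj mul0r subr0.
Qed.

Lemma arm_t_adj_coord (R : realType) (g : R -> R) (theta : R) :
  arm_t_adj g theta =
  fun u => \sum_(j < 4) [:: 1; - theta; 0; 0]`_j * g (u 0 j).
Proof.
apply/funext => u; rewrite !big_ord_recl big_ord0 /arm_t_adj /=.
have -> : lift ord0 ord0 = 1 :> 'I_4 by exact/val_inj.
have -> : ord0 = 0 :> 'I_4 by exact/val_inj.
ring.
Qed.

Lemma arm_c_adj_coord (R : realType) (g : R -> R) (theta : R) :
  arm_c_adj g theta =
  fun u => \sum_(j < 4) [:: 0; 0; 1; - theta]`_j * g (u 0 j).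
Proof.
apply/funext => u; rewrite !big_ord_recl big_ord0 /arm_c_adj /=.
have -> : lift ord0 (lift ord0 ord0) = 2 :> 'I_4 by exact/val_inj.
have -> : lift ord0 (lift ord0 (lift ord0 ord0)) = 3 :> 'I_4 by exact/val_inj.
ring.
Qed.

(** * Quadratics in theta, their minimizers, and the variance ratio *)

Theorem corollary3p3
  (R : realType) (d : measure_display) (T : measurableType d)
  (P : probability T R)
  (* units, treatment arm and control arm *)
  (I : finType) (t c : {set I})
  (arms : c = ~: t) (t_gt0 : (0 < #|t|)%N) (c_gt0 : (0 < #|c|)%N)
  (* observed responses, predictors, and the function f of the predictors *)
  (p : nat) (Y : I -> {RV P >-> R}) (X : I -> T -> 'rV[R]_p)
  (f : 'rV[R]_p -> R)
  (measH : forall i, measurable_fun setT (f \o X i))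
  (* potential responses of a random unit *)
  (Y1 Y0 : {RV P >-> R})
  (lawY1 : forall i, i \in t -> same_law P (Y i) Y1)
  (lawY0 : forall i, i \in c -> same_law P (Y i) Y0)
  (* the pairs (Y_t, H_t), (Y_c, H_c) of a randomly chosen unit of each arm *)
  (Yt Ht Yc Hc : {RV P >-> R})
  (law_t : forall i, i \in t ->
     same_law P (fun w => (Y i w, f (X i w))) (fun w => (Yt w, Ht w)))
  (law_c : forall i, i \in c ->
     same_law P (fun w => (Y i w, f (X i w))) (fun w => (Yc w, Hc w)))
  (indep : mutually_independent P (fun i w => (Y i w, f (X i w))))
  (momY : forall i, (Y i : T -> R) \in Lfun P 2%:E)
  (momH : forall i, f \o X i \in Lfun P 2%:E)
  (* the differentiable function g with domain D *)
  (D : set R) (g : R -> R)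
  (g_diff : forall x, D x -> derivable g x 1)
  (D_Yt : forall w, D (sample_mean t (fun i => Y i) w))
  (D_Ht : forall w, D (sample_mean t (fun i => f \o X i) w))
  (D_Yc : forall w, D (sample_mean c (fun i => Y i) w))
  (D_Hc : forall w, D (sample_mean c (fun i => f \o X i) w))
  (D_mY1 : D (mean P Y1)) (D_mY0 : D (mean P Y0))
  (D_mYt : D (mean P Yt)) (D_mHt : D (mean P Ht))
  (D_mYc : D (mean P Yc)) (D_mHc : D (mean P Hc))
  (sd_Yt : 0 < sd P Yt) (sd_Yc : 0 < sd P Yc)
  (sd_Ht : 0 < sd P Ht) (sd_Hc : 0 < sd P Hc)
  (dg_Yt : derive1 g (mean P Yt) != 0) (dg_Yc : derive1 g (mean P Yc) != 0)
  (dg_Ht : derive1 g (mean P Ht) != 0) (dg_Hc : derive1 g (mean P Hc) != 0) :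
  let U := averages t c (fun i => Y i) (fun i => f \o X i) in
  let V F := delta_var P F U in
  let theta1 := theta_arm g P Yc Hc in
  let theta2 := theta_arm g P Yt Ht in
  let optimal := minimizes (fun theta => V (tau_adj g theta)) in
  (* (a) *)
  [/\ forall theta,
        minimizes (fun theta => V (arm_c_adj g theta)) theta <->
        theta = theta1,
      forall theta,
        minimizes (fun theta => V (arm_t_adj g theta)) theta <->
        theta = theta2,
      exists! theta, optimal theta &
      forall theta, optimal theta ->
        Num.min theta1 theta2 <= theta <= Num.max theta1 theta2] /\
  (* (b) *)
  (derive1 g (mean P Hc) * sd P Hc = derive1 g (mean P Ht) * sd P Ht ->
   cor P Yc Hc * (derive1 g (mean P Yc) * sd P Yc)
     = cor P Yt Ht * (derive1 g (mean P Yt) * sd P Yt) ->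
   forall theta, optimal theta ->
     V (tau_adj g theta) / V (tau_raw g)
       <= 1 - Num.min (cor P Yc Hc ^+ 2) (cor P Yt Ht ^+ 2)).
Proof.
move=> U V theta1 theta2 optimal.
pose H i := f \o X i.
have mRV (Z : {RV P >-> R}) : measurable_fun [set: T] Z by exact: measurable_funPT.
have mom_t i : i \in t -> same_moments P (Y i) (H i) Yt Ht.
  by move=> /law_t; apply: same_law_moments => //; exact: measH.
have mom_c i : i \in c -> same_moments P (Y i) (H i) Yc Hc.
  by move=> /law_c; apply: same_law_moments => //; exact: measH.
have uncor i j : i != j ->
  [/\ cov P (Y i) (Y j) = 0, cov P (Y i) (H j) = 0 & cov P (H i) (H j) = 0].
  move=> ij; have WW A B := @mutually_independent2 _ _ _ _ _ _ _ _ i j A B indep ij.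
  have mf : measurable_fun setT (fst : R * R -> R) by exact: measurable_fst.
  have ms : measurable_fun setT (snd : R * R -> R) by exact: measurable_snd.
  have cov0 (h k : R * R -> R) mh mk h2 k2 :=
    @cov_indep _ _ _ P _ _ _ _ h k mh mk h2 k2 WW.
  split; [exact: (cov0 fst fst mf mf (momY i) (momY j))
         |exact: (cov0 fst snd mf ms (momY i) (momH j))
         |exact: (cov0 snd snd ms ms (momH i) (momH j))].
have VE k := delta_var_averages arms t_gt0 c_gt0 momY momH uncor mom_t mom_c
  (g_diff _ D_mYt) (g_diff _ D_mHt) (g_diff _ D_mYc) (g_diff _ D_mHc) k.

have Nt0 : 0 < #|t|%:R :> R by rewrite ltr0n.
have Nc0 : 0 < #|c|%:R :> R by rewrite ltr0n.
have vHt0 : 0 < var P Ht by rewrite -sqr_sd exprn_gt0.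
have vHc0 : 0 < var P Hc by rewrite -sqr_sd exprn_gt0.
pose at' := derive1 g (mean P Yt); pose bt := derive1 g (mean P Ht).
pose ac := derive1 g (mean P Yc); pose bc := derive1 g (mean P Hc).
(* Each arm contributes C - 2 theta B + theta^2 A: [At] and [Ac] come from H, [Ct] and [Cc] from Y,
   [Bt] and [Bc] from the cross term. *)
pose At := bt ^+ 2 * var P Ht / #|t|%:R.
pose Ac := bc ^+ 2 * var P Hc / #|c|%:R.
pose Bt := at' * bt * cov P Yt Ht / #|t|%:R.
pose Bc := ac * bc * cov P Yc Hc / #|c|%:R.
pose Ct := at' ^+ 2 * var P Yt / #|t|%:R.
pose Cc := ac ^+ 2 * var P Yc / #|c|%:R.
have At0 : 0 < At by rewrite divr_gt0// mulr_gt0// exprn_even_gt0.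
have Ac0 : 0 < Ac by rewrite divr_gt0// mulr_gt0// exprn_even_gt0.
have Ct0 : 0 < Ct by rewrite divr_gt0// mulr_gt0// ?exprn_even_gt0// -sqr_sd exprn_gt0.
have Cc0 : 0 < Cc by rewrite divr_gt0// mulr_gt0// ?exprn_even_gt0// -sqr_sd exprn_gt0.
have VtE x : V (arm_t_adj g x) = Ct - 2 * x * Bt + x ^+ 2 * At.
  by rewrite arm_t_adj_coord [V _]VE /= -/at' -/bt /Ct /Bt /At; ring.
have VcE x : V (arm_c_adj g x) = Cc - 2 * x * Bc + x ^+ 2 * Ac.
  by rewrite arm_c_adj_coord [V _]VE /= -/ac -/bc /Cc /Bc /Ac; ring.
(* The control arm enters with both signs reversed, which its quadratic form does not see. *)
have VadjE x : V (tau_adj g x) = Ct + Cc - 2 * x * (Bt + Bc) + x ^+ 2 * (At + Ac).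
  rewrite tau_adj_coord [V _]VE /= -/at' -/bt -/ac -/bc.
  by rewrite /Ct /Bt /At /Cc /Bc /Ac; ring.
have VrawE : V (tau_raw g) = Ct + Cc.
  by rewrite tau_raw_coord [V _]VE /= -/at' -/bt -/ac -/bc /Ct /Cc; ring.
have A0 : 0 < At + Ac by exact: addr_gt0.
have theta1E : theta1 = Bc / Ac.
  rewrite /theta1 /theta_arm -/ac -/bc /Bc /Ac; field.
  by rewrite dg_Hc !gt_eqF.
have theta2E : theta2 = Bt / At.
  rewrite /theta2 /theta_arm -/at' -/bt /Bt /At; field.
  by rewrite dg_Ht !gt_eqF.
have optE := minimizes_quadratic A0 VadjE.
split; first split.
- by move=> x; rewrite theta1E; exact: (minimizes_quadratic Ac0 VcE).
- by move=> x; rewrite theta2E; exact: (minimizes_quadratic At0 VtE).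
- by exists ((Bt + Bc) / (At + Ac)); split=> [|x /optE ->//]; exact/optE.
(* The optimum is the average of [theta1] and [theta2] with weights [Ac] and [At]. *)
- move=> _ /optE ->; have := mediant_between theta1 theta2 Ac0 At0.
  suff -> : (Ac * theta1 + At * theta2) / (Ac + At) = (Bt + Bc) / (At + Ac) by [].
  by rewrite theta1E theta2E (mulrC Ac) (mulrC At) !divfK ?gt_eqF//
    (addrC Bc) (addrC Ac).
move=> bs ks x /optE xE.
rewrite VrawE ler_pdivrMr ?addr_gt0// VadjE xE.
(* By [bs] and [ks], [s] and [k] take the same values in the control arm, so the A's and B's of the
   two arms differ only through the arm sizes. *)
pose s := bt * sd P Ht; pose k := cor P Yt Ht * (at' * sd P Yt).
have s0 : s != 0 by rewrite mulf_neq0// gt_eqF.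
have s2 : 0 < s ^+ 2 by rewrite exprn_even_gt0.
have AtE : At = s ^+ 2 / #|t|%:R by rewrite /At -sqr_sd /s; ring.
have AcE : Ac = s ^+ 2 / #|c|%:R by rewrite /Ac -sqr_sd /s -bs /bc; ring.
have BtE : Bt = k * s / #|t|%:R by rewrite /Bt cov_sd_cor// /k /s; ring.
have BcE : Bc = k * s / #|c|%:R.
  by rewrite /Bc cov_sd_cor// /k /s -bs -ks /ac /bc; ring.
(* The part of the Y-variance of each arm explained by H; bounding the squared correlations below by
   their minimum [r] gives [rt] and [rc]. *)
have kt : cor P Yt Ht ^+ 2 * Ct = k ^+ 2 / #|t|%:R.
  by rewrite /Ct -sqr_sd /k; ring.
have kc : cor P Yc Hc ^+ 2 * Cc = k ^+ 2 / #|c|%:R.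
  by rewrite /Cc -sqr_sd /k -ks /ac; ring.
set r := Num.min _ _.
have rt : r * Ct <= k ^+ 2 / #|t|%:R.
  by rewrite -kt ler_pM2r// ge_min lexx orbT.
have rc : r * Cc <= k ^+ 2 / #|c|%:R.
  by rewrite -kc ler_pM2r// ge_min lexx.
(* At the optimum the variance drops by (Bt + Bc)^2 / (At + Ac), in which [s] cancels. *)
have -> : Ct + Cc - 2 * ((Bt + Bc) / (At + Ac)) * (Bt + Bc) +
    ((Bt + Bc) / (At + Ac)) ^+ 2 * (At + Ac) =
    Ct + Cc - (k ^+ 2 / #|t|%:R + k ^+ 2 / #|c|%:R).
  have -> : (Bt + Bc) / (At + Ac) = k / s.
    rewrite AtE AcE BtE BcE; field.
    by rewrite s0 !gt_eqF//; apply: addr_gt0; exact: mulr_gt0.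
  by rewrite AtE AcE BtE BcE; field; rewrite s0 !gt_eqF.
by rewrite mulrBl mul1r lerD2l lerN2 mulrDr lerD.
Qed.
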